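(* Let $A,B$ be commutative rings with identity, let $f:A\to B$ be a ring homomorphism, and let $n$ be a positive integer. Let $(A,\mathfrak{m})$ be a quasi-local ring, $S$ a multiplicative subset of $A$ and $I$ an $\mathfrak{m}$-primary ideal of $A$. Suppose that $J$ is an ideal of $B$ such that $f^{-1}(Q)\neq\mathfrak{m}$ for every $Q\in\mathrm{Spec}(B)\setminus V(J)$, and that $H$ is an ideal of $f(A)+J$ such that $0=f(\mathfrak{m})J\subseteq H\subseteq J$. If $s\in S$ is such that $f(s)J^n\subseteq H$, then the following assertions are equivalent. (1) $I$ is an $S$-$n$-absorbing ideal of $A$ and associated to $s$. (2) $I\bowtie^f H$ is an $S^{\bowtie^f}$-$n$-absorbing ideal of $A\bowtie^f J$ and associated to $(s,f(s))$.
   Context: A quasi-local ring $(A,\mathfrak{m})$ is a commutative ring with unique maximal ideal $\mathfrak{m}$ (not necessarily Noetherian). $V(J)$ is the set of prime ideals of $B$ containing $J$. A multiplicative subset is a nonempty subset closed under multiplication (not necessarily saturated, and not required to contain $1$). The amalgamation of $A$ with $B$ along $J$ with respect to $f$ is the subring $A\bowtie^f J=\{(a,f(a)+j) : a\in A,\ j\in J\}$ of $A\times B$. For an ideal $I$ of $A$ and an ideal $H$ of the subring $f(A)+J$ of $B$ with $f(I)J\subseteq H\subseteq J$, $I\bowtie^f H=\{(i,f(i)+h) : i\in I,\ h\in H\}$, which is an ideal of $A\bowtie^f J$. Also $S^{\bowtie^f}=\{(s,f(s)) : s\in S\}$, a multiplicative subset of $A\bowtie^f J$. For a commutative ring $R$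 with identity, a multiplicative subset $T$ of $R$, an ideal $L$ of $R$ and $t\in T$: $L$ is a $T$-$n$-absorbing ideal associated to $t$ if $L$ is disjoint from $T$ and whenever $r_1,\dots,r_{n+1}\in R$ satisfy $r_1\cdots r_{n+1}\in L$, there is $1\le j\le n+1$ with $t\prod_{1\le i\le n+1,\, i\ne j} r_i\in L$. *)

(* Defs.v *)
From HB Require Import structures.
From mathcomp Require Import all_boot all_order all_algebra.
From mathcomp Require Import mathcomp_extra boolp classical_sets functions.

Set Implicit Arguments.
Unset Strict Implicit.
Unset Printing Implicit Defensive.

Import GRing.Theory.
Local Open Scope classical_set_scope.
Local Open Scope ring_scope.

(* Rings are commutative with 1 and may be trivial (comPzRingType), and ideals
   may be improper; this is why ring_quotient's idealr_closed, which forces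
   properness over a nontrivial ring, is not used. *)

Section Ideals.
Variable R : comPzRingType.
Implicit Types I J P M L T X Y : set R.

Definition is_ideal I : Prop :=
  [/\ I 0, forall x y, I x -> I y -> I (x + y)
    & forall a x, I x -> I (a * x)].

Definition is_prime P : Prop :=
  [/\ is_ideal P, ~ P 1 & forall x y, P (x * y) -> P x \/ P y].

Definition is_maximal M : Prop :=
  [/\ is_ideal M, ~ M 1
    & forall I, is_ideal I -> M `<=` I -> I = M \/ I = setT].

Definition quasi_local M : Prop :=
  is_maximal M /\ (forall M', is_maximal M' -> M' = M).

Definition Spec : set (set R) := [set P | is_prime P].

Definition V J : set (set R) := [set P | is_prime P /\ J `<=` P].

Definition radical I : set R := [set x | exists k : nat, I (x ^+ k)].

Definition is_primary I : Prop :=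
  [/\ is_ideal I, ~ I 1
    & forall x y, I (x * y) -> I x \/ exists k : nat, I (y ^+ k)].

Definition primary_to M I : Prop := is_primary I /\ radical I = M.

Definition ideal_mul X Y : set R :=
  smallest is_ideal [set z | exists x y, [/\ X x, Y y & z = x * y]].

Definition ideal_exp J (n : nat) : set R := iter n (ideal_mul J) setT.

(* 1 is not required to belong to T. *)
Definition multiplicative T : Prop :=
  T !=set0 /\ (forall x y, T x -> T y -> T (x * y)).

Definition n_absorbing T (n : nat) L (t : R) : Prop :=
  [/\ multiplicative T, is_ideal L, T t, L `&` T = set0
    & forall r : 'I_n.+1 -> R, L (\prod_i r i) ->
        exists j : 'I_n.+1, L (t * \prod_(i | i != j) r i)].

End Ideals.

Arguments Spec R : clear implicits.

Section Subring.
Variables (R : comPzRingType) (D : set R).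

(* The closure proof is an argument of the type so that the ring structure can
   be inferred from it. *)
Record subring (hD : subring_closed [in D]) : Type :=
  Subring { subring_val : R; _ : subring_val \in D }.

Variable hD : subring_closed [in D].

HB.instance Definition _ := [isSub for @subring_val hD].
HB.instance Definition _ := [Choice of subring hD by <:].
HB.instance Definition _ :=
  GRing.SubChoice_isSubComPzRing.Build R [in D] (subring hD) hD.

End Subring.

Section Amalgamation.
Variables (A B : comPzRingType) (f : {rmorphism A -> B}) (J : set B).
Hypothesis hJ : is_ideal J.

Definition amalg_set : set (A * B) :=
  [set p | exists a j, J j /\ p = (a, f a + j)].

Definition image_add_set : set B :=
  [set b | exists a j, J j /\ b = f a + j].

Lemma is_idealN (x : B) : J x -> J (- x).
Proof. by case: hJ => _ _ hM Jx; rewrite -mulN1r; apply: hM. Qed.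

Lemma amalg_subring_closed : subring_closed [in amalg_set].
Proof.
case: (hJ) => J0 JD JM; split.
- by rewrite inE; exists 1, 0; rewrite rmorph1 addr0.
- move=> _ _ /set_mem[a [j [Jj ->]]] /set_mem[b [k [Jk ->]]].
  rewrite inE; exists (a - b), (j - k); split.
    by apply: JD => //; exact: is_idealN.
  by congr pair; rewrite rmorphB /= opprD addrACA.
- move=> _ _ /set_mem[a [j [Jj ->]]] /set_mem[b [k [Jk ->]]].
  rewrite inE; exists (a * b), (f a * k + (f b + k) * j); split.
    by apply: JD; apply: JM.
  by congr pair; rewrite rmorphM /= mulrDl mulrDr -addrA [j * _]mulrC.
Qed.

Lemma image_add_subring_closed : subring_closed [in image_add_set].
Proof.
case: (hJ) => J0 JD JM; split.
- by rewrite inE; exists 1, 0; rewrite rmorph1 addr0.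
- move=> _ _ /set_mem[a [j [Jj ->]]] /set_mem[b [k [Jk ->]]].
  rewrite inE; exists (a - b), (j - k); split.
    by apply: JD => //; exact: is_idealN.
  by rewrite rmorphB /= opprD addrACA.
- move=> _ _ /set_mem[a [j [Jj ->]]] /set_mem[b [k [Jk ->]]].
  rewrite inE; exists (a * b), (f a * k + (f b + k) * j); split.
    by apply: JD; apply: JM.
  by rewrite rmorphM /= mulrDl mulrDr -addrA [j * _]mulrC.
Qed.

(* The rings A ⋈^f J and f(A) + J. *)
Notation amalg := (subring amalg_subring_closed).
Notation image_add := (subring image_add_subring_closed).

Lemma amalg_diag_proof (a : A) :
  (a, f a) \in amalg_set.
Proof. by case: hJ => J0 _ _; rewrite inE; exists a, 0; rewrite addr0. Qed.

Definition amalg_diag (a : A) : amalg :=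
  Subring amalg_subring_closed (amalg_diag_proof a).

Definition amalg_ideal (I : set A) (H : set image_add) : set amalg :=
  [set x | exists i h, [/\ I i, H h & val x = (i, f i + val h)]].

Definition amalg_mult (S : set A) : set amalg := [set amalg_diag s | s in S].

End Amalgamation.

Arguments amalg_diag {A B} f {J} hJ a.
Arguments amalg_ideal {A B} f {J} hJ I H.
Arguments amalg_mult {A B} f {J} hJ S.

Notation amalg f hJ := (subring (amalg_subring_closed f hJ)).
Notation image_add f hJ := (subring (image_add_subring_closed f hJ)).

(* Main.v *)
Require Import Defs.
From mathcomp Require Import all_boot all_order all_algebra.
From mathcomp Require Import boolp classical_sets functions.

(** If a prime [Q] of [B] does not contain [J], then [f m * J = 0] forces
    [f^-1 Q] to contain [m], hence to equal it; so the hypothesis on [Spec B]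
    puts [J] inside every prime of [B]. Therefore [(a, f a + j)] is a unit of
    the amalgamation as soon as [a] lies outside [m]. Given a product in the
    amalgamated ideal, either some factor is such a unit and can be cancelled,
    or all first components lie in [m]; in the latter case the cross terms
    vanish and [n] of the factors multiply to
    [(prod a_i, f (prod a_i) + prod j_i)] with [prod j_i] in [J ^ n]. *)

Local Open Scope classical_set_scope.
Local Open Scope ring_scope.

(* [Defs] is imported again because [GRing.Theory] shadows [multiplicative]. *)
Import GRing.Theory Defs.

Set Implicit Arguments.
Unset Strict Implicit.
Unset Printing Implicit Defensive.

(** * Maximal ideals, units and products of sums in a commutative ring *)

Section IdealTheory.
Context {R : comPzRingType}.
Implicit Types (I M : set R) (a x : R).

Lemma ideal_add_principal I a :
  is_ideal I -> is_ideal [set y | exists i c, I i /\ y = i + c * a].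
Proof.
case=> I0 ID IM; split.
- by exists 0, 0; rewrite mul0r addr0.
- move=> _ _ [i [c [Ii ->]]] [k [d [Ik ->]]]; exists (i + k), (c + d).
  by split; [exact: ID | rewrite mulrDl addrACA].
- move=> b _ [i [c [Ii ->]]]; exists (b * i), (b * c).
  by split; [exact: IM | rewrite mulrDr mulrA].
Qed.

Lemma maximal_prime M : is_maximal M -> is_prime M.
Proof.
case=> Mid M1 Mmax; split=> // x y Mxy; have [M0 MD MM] := Mid.
have [|nMx] := pselect (M x); first by left.
right; have sub : M `<=` [set y | exists i c, M i /\ y = i + c * x].
  by move=> i Mi; exists i, 0; rewrite mul0r addr0.
case: (Mmax _ (ideal_add_principal x Mid) sub) => [eqM|eqT].
  by case: nMx; rewrite -eqM; exists 0, 1; rewrite mul1r add0r.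
have : [set: R] 1 by [].
rewrite -eqT => -[i [c [Mi e]]].
rewrite -[y]mul1r e mulrDl; apply: MD; first by rewrite mulrC; exact: MM.
by rewrite -mulrA; exact: MM.
Qed.

(* [Zorn_bigcup] also asks for the union of the empty chain, whence [set0]
   among the candidates. *)
Lemma maximal_of_nonunit a :
  (forall b, b * a <> 1) -> exists2 M, is_maximal M & M a.
Proof.
move=> nu; pose P X := X = set0 \/ [/\ is_ideal X, X a & ~ X 1].
have Pa : P [set y | exists i c, [set 0] i /\ y = i + c * a].
  right; split.
  - apply: ideal_add_principal; split=> //.
      by move=> x y -> ->; rewrite addr0.
    by move=> c x ->; rewrite mulr0.
  - by exists 0, 1; rewrite mul1r add0r.
  - by case=> _ [c [-> /esym]]; rewrite add0r; exact: nu.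
case: (@Zorn_bigcup _ P) => [F FP Ftot|M [PM Mmax]].
  have [[X0 [FX0 nX0]]|none] :=
      pselect (exists X, F X /\ X <> set0); last first.
    left; rewrite -subset0 => x [X FX Xx]; apply: none; exists X; split=> //.
    by move=> X0; rewrite X0 in Xx.
  have idF X x : F X -> X x -> [/\ is_ideal X, X a & ~ X 1].
    by move=> FX Xx; case: (FP _ FX) => // X_0; rewrite X_0 in Xx.
  case: (FP _ FX0) => // -[[Z0 _ _] Za _].
  right; split; [split|by exists X0|].
  - by exists X0.
  - move=> x y [X FX Xx] [Y FY Yy].
    have [[_ XD _] _ _] := idF _ _ FX Xx; have [[_ YD _] _ _] := idF _ _ FY Yy.
    by case: (Ftot _ _ FX FY) => sub; [exists Y|exists X] => //;
       [apply: YD => //|apply: XD => //]; exact: sub.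
  - move=> c x [X FX Xx]; exists X => //.
    by have [[_ _ XM] _ _] := idF _ _ FX Xx; exact: XM.
  - by case=> X FX X1; have [_ _] := idF _ _ FX X1.
case: PM => [M0|[Mid Ma M1]].
  (* The empty candidate is not maximal: the principal ideal of [a] lies strictly above it. *)
  exfalso; apply: (Mmax _ _ Pa); rewrite M0; split=> // sub.
  by case: (sub a); exists 0, 1; rewrite mul1r add0r.
exists M => //; split=> // L Lid ML; have [L1|nL1] := pselect (L 1).
  right; apply/seteqP; split=> // x _; case: Lid => _ _ LM.
  by rewrite -[x]mulr1; exact: LM.
left; apply: contrapT => LM; apply: (Mmax L).
  by split=> // LM'; apply: LM; apply/seteqP.
by right; split=> //; exact: ML.
Qed.

(** A nonunit lies in some maximal ideal, and [M] is the only one. *)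
Lemma quasi_local_inv M a : quasi_local M -> ~ M a -> exists b, b * a = 1.
Proof.
move=> [_ Muniq] nMa; apply: contrapT => /forallNP /maximal_of_nonunit[N maxN Na].
by apply: nMa; rewrite -(Muniq N).
Qed.

Lemma ideal_exp_prod {K : Type} (J : set R) (r : seq K) (v : K -> R) :
  (forall i, J (v i)) -> ideal_exp J (size r) (\prod_(i <- r) v i).
Proof.
move=> Jv; elim: r => [|x r IH] //=.
by rewrite big_cons => X [_ sX]; apply: sX; exists (v x), (\prod_(i <- r) v i).
Qed.

(** Every mixed term of the expansion contains some [u i * v k], hence vanishes. The list must be
    nonempty, since for the empty one the two sides are [1] and [1 + 1]. *)
Lemma prod_add_orthogonal {K : Type} (r : seq K) (u v : K -> R) :
  (forall i k, u i * v k = 0) -> (0 < size r)%N ->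
  \prod_(i <- r) (u i + v i) = \prod_(i <- r) u i + \prod_(i <- r) v i.
Proof.
move=> uv; elim: r => [|x [|y r] IH] //= _; first by rewrite !big_seq1.
rewrite big_cons IH // [in RHS]big_cons [in X in _ = _ + X]big_cons.
have -> : v x * \prod_(i <- y :: r) v i =
    (u x + v x) * \prod_(i <- y :: r) v i.
  by rewrite mulrDl [u x * _](_ : _ = 0) ?add0r // big_cons mulrA uv mul0r.
rewrite mulrDr; congr (_ + _); rewrite mulrDl [X in _ + X](_ : _ = 0) ?addr0 //.
by rewrite big_cons mulrA [v x * _]mulrC uv mul0r.
Qed.

End IdealTheory.

(** * Ideals, units and absorption in the amalgamation *)

Section Amalgamation.
Context {A B : comPzRingType} {f : {rmorphism A -> B}}.
Context {J : set B} {hJ : is_ideal J}.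
Implicit Types (I m : set A) (H : set (image_add f hJ)) (x y : amalg f hJ).

(** The witnesses in [amalg_ideal] are forced by the components of [x], so membership splits into a
    test on the first component and a test on the [J]-part. *)
Lemma amalg_idealP {I H x} :
  amalg_ideal f hJ I H x <->
  I (val x).1 /\ (val @` H) ((val x).2 - f (val x).1).
Proof.
split=> [[i [h [Ii Hh ->]]]|[Ii [h Hh e]]] /=.
  by split=> //; exists h => //; rewrite addrC addKr.
exists (val x).1, h; split=> //.
by rewrite e addrC subrK -surjective_pairing.
Qed.

Lemma amalg_sub_mem x : J ((val x).2 - f (val x).1).
Proof.
have /set_mem[a [j [Jj ->]]] /= := valP x.
by rewrite addrC addKr.
Qed.

Lemma is_ideal_amalg I H :
  is_ideal I -> is_ideal H -> (forall i j, I i -> J j -> f i * j = 0) ->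
  is_ideal (amalg_ideal f hJ I H).
Proof.
move=> [I0 ID IM] [H0 HD HM] IJ0; split.
- by apply/amalg_idealP; split=> //=; exists 0; rewrite //= rmorph0 subrr.
- move=> x y /amalg_idealP[Ix [h Hh eh]] /amalg_idealP[Iy [k Hk ek]].
  apply/amalg_idealP; split; first exact: ID.
  exists (h + k); first exact: HD.
  by rewrite raddfD /= eh ek rmorphD opprD addrACA.
- move=> a x /amalg_idealP[Ix [h Hh eh]].
  apply/amalg_idealP; split; first exact: IM.
  (* With [a = (a1, a2)] and [x = (x1, x2)], the [J]-part of [a * x] is
     [a2 * (x2 - f x1) + (a2 - f a1) * f x1]. The second term is in [f I * J = 0], and the first is
     in [H] because [a2] is in [f A + J]. *)
  have Da : (val a).2 \in image_add_set f J.
    rewrite inE; exists (val a).1, ((val a).2 - f (val a).1).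
    by split; [exact: amalg_sub_mem | rewrite addrC subrK].
  exists (Subring (image_add_subring_closed f hJ) Da * h); first exact: HM.
  rewrite rmorphM /= eh mulrBr rmorphM /=; congr (_ - _).
  apply/eqP; rewrite -subr_eq0 -mulrBl mulrC; apply/eqP.
  by apply: IJ0 => //; exact: amalg_sub_mem.
Qed.

Lemma amalg_inv x (a : A) (b : B) :
  a * (val x).1 = 1 -> b * (val x).2 = 1 -> exists y, y * x = 1.
Proof.
move=> ea eb.
have Dab : (a, b) \in amalg_set f J.
  rewrite inE; exists a, (b - f a); split; last by rewrite addrC subrK.
  (* The inverse in [A * B] stays in the amalgamation: as for a difference of two inverses,
     [b - f a] is a multiple of [x2 - f x1]. *)
  have -> : b - f a = - (b * f a) * ((val x).2 - f (val x).1).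
    rewrite mulrBr !mulNr opprK [RHS]addrC -[b * _ * f _]mulrA -rmorphM ea.
    by rewrite rmorph1 mulr1 mulrAC eb mul1r.
  by have [_ _ JM] := hJ; apply: JM; exact: amalg_sub_mem.
exists (Subring (amalg_subring_closed f hJ) Dab); apply: val_inj.
rewrite rmorphM rmorph1 /=.
by rewrite [val x]surjective_pairing -[LHS]/(a * _, b * _) ea eb.
Qed.

Lemma multiplicative_amalg (S : set A) :
  multiplicative S -> multiplicative (amalg_mult f hJ S).
Proof.
move=> [[s Ss] SM]; split; first by exists (amalg_diag f hJ s), s.
move=> _ _ [a Sa <-] [b Sb <-]; exists (a * b); first exact: SM.
by apply: val_inj; rewrite rmorphM /= rmorphM.
Qed.

Lemma ideal_sub_prime m (Q : set B) :
  quasi_local m -> (forall i j, m i -> J j -> f i * j = 0) ->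
  (forall P, (Spec B `\` V J) P -> f @^-1` P <> m) ->
  is_prime Q -> J `<=` Q.
Proof.
move=> [[mid m1 mmax] _] mJ0 hSpec Qpr; apply: contrapT => nJQ.
have nVQ : (Spec B `\` V J) Q by split=> // -[].
have [[Q0 QD QM] Q1 Qp] := Qpr.
case/existsNP: nJQ => j /not_implyP[Jj nQj].
have fQid : is_ideal (f @^-1` Q).
  split=> [|x y|a x] /=; rewrite ?rmorph0 ?rmorphD ?rmorphM //.
  - exact: QD.
  - exact: QM.
(* For [i] in [m], the product [f i * j = 0] is in [Q] while [j] is not. *)
have mQ : m `<=` f @^-1` Q by move=> i mi; case: (Qp (f i) j); rewrite ?mJ0.
case: (mmax _ fQid mQ) => [/hSpec|fQT]; first exact.
have : [set: A] 1 by [].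
by rewrite -fQT /= rmorph1.
Qed.

(** A maximal ideal containing the second component would also contain [J], hence [f] of the first
    component, which is a unit. *)
Lemma amalg_quasi_local_inv m x :
  quasi_local m -> (forall Q : set B, is_prime Q -> J `<=` Q) ->
  ~ m (val x).1 -> exists y, y * x = 1.
Proof.
move=> mloc JQ nmx; have [a ea] := quasi_local_inv mloc nmx.
suff [b eb] : exists b, b * (val x).2 = 1 by exact: amalg_inv ea eb.
apply: contrapT => /forallNP /maximal_of_nonunit[Q /maximal_prime Qpr Qx].
have [[_ QD QM] Q1 _] := Qpr; apply: Q1.
rewrite -(rmorph1 f) -ea rmorphM; apply: (QM); rewrite -[f _](subKr (val x).2).
rewrite -mulN1r; apply: (QD) => //; apply: (QM).
by apply: (JQ _ Qpr); exact: amalg_sub_mem.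
Qed.

(** Factors in [A] are lifted along the diagonal, which is multiplicative and has [J]-part 0, an
    element of [H]. *)
Lemma n_absorbing_of_amalg (S : set A) n I H (s : A) :
  multiplicative S -> is_ideal I -> S s -> is_ideal H ->
  n_absorbing (amalg_mult f hJ S) n (amalg_ideal f hJ I H) (amalg_diag f hJ s) ->
  n_absorbing S n I s.
Proof.
move=> hS Iid Ss [H0 _ _] [_ _ _ disj abs].
have diagI a : I a -> amalg_ideal f hJ I H (amalg_diag f hJ a).
  move=> Ia; apply/amalg_idealP; split=> //=.
  by exists 0 => //; rewrite subrr.
split=> //.
  rewrite -subset0 => x [Ix Sx]; rewrite -[set0 x]/False.
  have : (amalg_ideal f hJ I H `&` amalg_mult f hJ S) (amalg_diag f hJ x).
    by split; [exact: diagI | exists x].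
  by rewrite disj.
have diag_prod (P : pred 'I_n.+1) (r : 'I_n.+1 -> A) :
    \prod_(i | P i) amalg_diag f hJ (r i) =
    amalg_diag f hJ (\prod_(i | P i) r i).
  apply: (big_ind2 (fun x a => x = amalg_diag f hJ a)) => //.
  - by apply: val_inj; rewrite rmorph1 /= rmorph1.
  - by move=> _ a _ b -> ->; apply: val_inj; rewrite rmorphM /= rmorphM.
move=> r Ir; case: (abs (fun i => amalg_diag f hJ (r i))) => [|j].
  by rewrite diag_prod; exact: diagI.
by rewrite diag_prod => /amalg_idealP[]; exists j.
Qed.

Lemma n_absorbing_amalg (S : set A) n m I H (s : A) :
  (0 < n)%N -> is_ideal H ->
  I `<=` m -> (forall i j, m i -> J j -> f i * j = 0) ->
  (forall x, ~ m (val x).1 -> exists y, y * x = 1) ->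
  [set f s * b | b in ideal_exp J n] `<=` val @` H ->
  n_absorbing S n I s ->
  n_absorbing (amalg_mult f hJ S) n (amalg_ideal f hJ I H) (amalg_diag f hJ s).
Proof.
move=> n0 Hid Im mJ0 unit_x sJH [hS Iid Ss disj abs].
have Lid : is_ideal (amalg_ideal f hJ I H).
  by apply: is_ideal_amalg => // i j /Im; exact: mJ0.
split=> //; first exact: multiplicative_amalg; first by exists s.
  rewrite -subset0 => z [/amalg_idealP[Ix _] [x Sx xe]].
  rewrite -[set0 z]/False -[False]/(set0 x) -disj; split=> //.
  by rewrite -xe in Ix.
move=> r Lr; have [_ _ LM] := Lid.
have [[k /unit_x[y yrk]]|/forallNP allm] :=
    pselect (exists k, ~ m (val (r k)).1).
  (* Cancelling the unit [r k] puts the product of the other factors in the ideal, even before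
     multiplying by the diagonal of [s]. *)
  exists k; apply: (LM); move: Lr; rewrite (bigD1 k) //= => /(LM y).
  by rewrite mulrA yrk mul1r.
pose a i := (val (r i)).1; pose d i := (val (r i)).2 - f (a i).
have val1 (P : pred 'I_n.+1) :
    (val (\prod_(i | P i) r i)).1 = \prod_(i | P i) a i.
  by rewrite !rmorph_prod.
(* The index [j] that [I] supplies for the first components serves for the whole pairs. *)
have [|j Ij] := abs a; first by rewrite -val1; case/amalg_idealP: Lr.
exists j; apply/amalg_idealP; split; first by rewrite rmorphM /= val1.
rewrite rmorphM /= val1 rmorphM -mulrBr; apply: sJH.
exists ((val (\prod_(i | i != j) r i)).2 - f (\prod_(i | i != j) a i)) => //.
(* As a list, the [n] indices other than [j] give the exponent in [ideal_exp J n]; [0 < n] makes the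
   list nonempty for [prod_add_orthogonal]. *)
pose t := enum (predC1 j).
have size_t : size t = n by rewrite -cardE cardC1 card_ord.
have -> : (val (\prod_(i | i != j) r i)).2 - f (\prod_(i | i != j) a i) =
    \prod_(i <- t) d i.
  rewrite !rmorph_prod -!big_enum /= -[enum _]/t.
  rewrite (eq_bigr (fun i => f (a i) + d i)); last first.
    by move=> i _; rewrite addrC subrK.
  rewrite prod_add_orthogonal; last by rewrite size_t.
    by rewrite addrC addKr.
  by move=> i k; apply: mJ0; [exact: contrapT (allm i)|exact: amalg_sub_mem].
have Jd i : J (d i) by exact: amalg_sub_mem.
by have := ideal_exp_prod t Jd; rewrite size_t.
Qed.

End Amalgamation.

Theorem theorem5p10 (A B : comPzRingType) (f : {rmorphism A -> B})
  (n : nat) (hn : (0 < n)%N)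
  (m : set A) (hm : quasi_local m)
  (S : set A) (hS : multiplicative S)
  (I : set A) (hI : primary_to m I)
  (J : set B) (hJ : is_ideal J)
  (hSpec : forall Q : set B, (Spec B `\` V J) Q -> f @^-1` Q <> m)
  (H : set (image_add f hJ)) (hH : is_ideal H)
  (hmJ0 : ideal_mul (f @` m) J = [set 0])
  (hmJH : ideal_mul (f @` m) J `<=` val @` H)
  (hHJ : val @` H `<=` J)
  (s : A) (hs : S s)
  (hsJH : [set f s * x | x in ideal_exp J n] `<=` val @` H) :
  n_absorbing S n I s <->
  n_absorbing (amalg_mult f hJ S) n (amalg_ideal f hJ I H) (amalg_diag f hJ s).
Proof.
have mJ0 i j : m i -> J j -> f i * j = 0.
  move=> mi Jj; rewrite -[_ = 0]/([set 0] (f i * j)) -hmJ0 => X [_ sX].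
  by apply: sX; exists (f i), j; split=> //; exists i.
have [[Iid _ _] radI] := hI.
split; last exact: n_absorbing_of_amalg.
apply: (n_absorbing_amalg (m := m)) => //.
- by move=> x Ix; rewrite -radI; exists 1%N; rewrite expr1.
- move=> x; apply: amalg_quasi_local_inv => //.
  by move=> Q; apply: ideal_sub_prime hSpec.
Qed.
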